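(* Let $\nu_\phi$ be the $T$-invariant Gibbs probability measure on $\mathbb{S}^1$ associated to a normalized Hölder potential $\phi$, where $T$ is the doubling map. Let $$\kappa^F_{\phi,\mathbb{S}^1}:=\sup\{\kappa>0:\ F^\kappa(s)=\emptyset \text{ for } \nu_\phi\text{-a.e. } s\},\qquad e^+:=\sup_{\nu}\int(-\phi)\,d\nu,$$ the last supremum being over all $T$-invariant Borel probability measures $\nu$ on $\mathbb{S}^1$. Then $$\kappa^F_{\phi,\mathbb{S}^1}=\frac1{e^+}.$$
   Context: $\mathbb{S}^1=\mathbb{R}/\mathbb{Z}$ and $T:\mathbb{S}^1\to\mathbb{S}^1$, $Ts=2s \pmod 1$. All logarithms and exponentials are to base 2 (so entropies and pressures are computed in base 2). A Hölder potential $\phi$ is normalized if its pressure $P(\phi)=\sup_\nu\{h_\nu+\int\phi\,d\nu\}$ (sup over $T$-invariant probability measures) is $0$; the Gibbs measure $\nu_\phi$ is the $T$-invariant probability measure for which $\nu_\phi(J)$ is comparable, uniformly in $n$, in the dyadic interval $J$ of length $2^{-n}$ and in $x\in J$, to $2^{\sum_{j=0}^{n-1}\phi(T^jx)}$. For $\kappa>0$ and $s\in\mathbb{S}^1$ put $J^\kappa_n(s)=(T^ns-n^{-\kappa} \bmod 1,\ T^ns+n^{-\kappa} \bmod 1)$ for $n\ge1$, and $F^\kappa(s)=\bigcup_{N=1}^\infty\bigcap_{n=N}^\infty (\mathbb{S}^1\setminus J^\kappa_n(s))$, i.e. the set of points that lie in only finitely many of the intervals $J_n^\kappa(s)$. 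*)

(* Defs.v *)
From HB Require Import structures.
From mathcomp Require Import all_boot all_order all_algebra.
From mathcomp Require Import all_classical all_reals all_analysis.

Set Implicit Arguments.
Unset Strict Implicit.
Unset Printing Implicit Defensive.

Import Order.TTheory GRing.Theory Num.Theory.
Import numFieldNormedType.Exports.

Local Open Scope classical_set_scope.
Local Open Scope ring_scope.

(* A point of R/Z is encoded by its unique representative in [0, 1).  The
   trace on [0, 1) of the Borel sets of R corresponds to the Borel
   sigma-algebra of R/Z. *)
Record circle (R : realType) : Type := Circle {
  circle_val : R ;
  circle_valP : 0 <= circle_val < 1 }.

Section circle_structures.
Variable R : realType.

HB.instance Definition _ := [isSub for @circle_val R].
HB.instance Definition _ := [Choice of circle R by <:].

Fact circle0_subproof : 0 <= (0 : R) < 1.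
Proof. by rewrite lexx ltr01. Qed.

HB.instance Definition _ := isPointed.Build (circle R) (Circle circle0_subproof).

Let borel_circle := g_sigma_algebra_preimageType (@circle_val R).

HB.instance Definition _ :=
  @isMeasurable.Build (preimage_display (@circle_val R)) (circle R)
    (g_sigma_algebra_preimage (@circle_val R))
    (@measurable0 _ borel_circle) (@measurableC _ borel_circle)
    (@bigcupT_measurable _ borel_circle).

Fact mod1_subproof (x : R) : 0 <= x - (Num.floor x)%:~R < 1.
Proof. by rewrite subr_ge0 floor_le /= ltrBlDl -intrD1 floorD1_gt. Qed.

Definition mod1 (x : R) : circle R := Circle (mod1_subproof x).

Definition circle_dist (x y : circle R) : R :=
  let r : R := `|circle_val x - circle_val y| in Num.min r (1 - r).

Definition doubling (s : circle R) : circle R := mod1 (2 * circle_val s).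

Definition is_holder (phi : circle R -> R) : Prop :=
  exists a C : R, [/\ 0 < a, a <= 1 &
    forall x y, `|phi x - phi y| <= C * circle_dist x y `^ a].

Definition dyadic (n k : nat) : set (circle R) :=
  [set x | k%:R / 2 ^+ n <= circle_val x < k.+1%:R / 2 ^+ n].

Definition birkhoff_sum (phi : circle R -> R) (n : nat) (x : circle R) : R :=
  \sum_(0 <= j < n) phi (iter j doubling x).

End circle_structures.

Section entropy.
Context {d : measure_display} {X : measurableType d} {R : realType}.
Variables (f : X -> X) (mu : probability X R).

Definition invariant_measure : Prop :=
  forall A : set X, measurable A -> mu (f @^-1` A) = mu A.

(* [ln 0 = 0] in the library, hence [0 * log2 0 = 0]. *)
Definition log2 (x : R) : R := ln x / ln 2.

(* A finite measurable partition is given by its labelling [xi]; the atoms of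
   the join of its preimages under f^0, ..., f^(n-1) are indexed by words. *)
Definition measurable_partition (k : nat) (xi : X -> 'I_k) : Prop :=
  forall i, measurable (xi @^-1` [set i]).

Definition join_atom (k : nat) (xi : X -> 'I_k) (n : nat)
    (w : {ffun 'I_n -> 'I_k}) : set X :=
  [set x | forall i : 'I_n, xi (iter i f x) = w i].

Definition join_entropy (k : nat) (xi : X -> 'I_k) (n : nat) : R :=
  - \sum_(w : {ffun 'I_n -> 'I_k})
      fine (mu (join_atom xi w)) * log2 (fine (mu (join_atom xi w))).

Definition partition_entropy (k : nat) (xi : X -> 'I_k) : R :=
  lim ((join_entropy xi n / n%:R) @[n --> \oo]).

Definition entropy : \bar R :=
  ereal_sup [set h | exists (k : nat) (xi : X -> 'I_k),
    measurable_partition xi /\ h = (partition_entropy xi)%:E].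

End entropy.

Section thermodynamics.
Variables (R : realType) (phi : circle R -> R).

Definition pressure : \bar R :=
  ereal_sup [set (entropy (@doubling R) mu + \int[mu]_x (phi x)%:E)%E
            | mu in [set mu : probability (circle R) R
                    | invariant_measure (@doubling R) mu]].

Definition is_gibbs (nu : probability (circle R) R) : Prop :=
  invariant_measure (@doubling R) nu /\
  exists c : R, 0 < c /\
    forall (n k : nat) (x : circle R), (k < 2 ^ n)%N -> dyadic n k x ->
      ((c^-1 * 2 `^ birkhoff_sum phi n x)%:E <= nu (dyadic n k))%E /\
      (nu (dyadic n k) <= (c * 2 `^ birkhoff_sum phi n x)%:E)%E.

Definition e_plus : \bar R :=
  ereal_sup [set (\int[mu]_x (- phi x)%:E)%E
            | mu in [set mu : probability (circle R) R
                    | invariant_measure (@doubling R) mu]].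

End thermodynamics.

Section covering.
Variable R : realType.

Definition J_arc (kappa : R) (n : nat) (s : circle R) : set (circle R) :=
  let c := circle_val (iter n (@doubling R) s) in
  @mod1 R @` `]c - n%:R `^ (- kappa), c + n%:R `^ (- kappa)[.

Definition finitely_covered (kappa : R) (s : circle R) : set (circle R) :=
  \bigcup_(N in [set N | (1 <= N)%N])
    \bigcap_(n in [set n | (N <= n)%N]) ~` J_arc kappa n s.

Definition kappa_F (nu : probability (circle R) R) : \bar R :=
  ereal_sup [set kappa%:E | kappa in [set kappa : R | 0 < kappa /\
    {ae nu, forall s, finitely_covered kappa s = set0}]].

End covering.

(* Main.v *)
From HB Require Import structures.
Require Import Defs.
From mathcomp Require Import all_boot all_order all_algebra.
From mathcomp Require Import all_classical all_reals all_analysis.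
From mathcomp Require Import measurable_realfun.
From mathcomp Require Import zify ring lra.

(** Write [e] for [e_plus phi], [T] for the doubling map and [S_n phi] for the
    Birkhoff sums.  Everything is read off dyadic intervals, that is, off the
    binary coding of the circle, and off periodic points.

    Each dyadic interval of level [m] contains a point [y] of period [m + 2]:
    append the digits 01 to its word and repeat.  The uniform measure on the
    orbit of [y] is invariant, hence [- S_(m+2) phi y <= (m + 2) * e], and the
    Gibbs property yields [nu J >= c1 * 2^(- m e)] for all dyadic [J] of level
    [m] ([gibbs_lower_bound]).  As these [2^m] measures add up to 1, [e > 0].

    If [kappa * e < 1], almost every orbit visits, for infinitely many levels
    [m], every dyadic interval of level [m] at some time [n] with
    [m <= n <= 2^(m / kappa)]; such a visit puts the whole interval inside the
    arc of index [n], so no point is covered only finitely often.  Indeed the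
    Gibbs property gives [nu (I J) >= b * nu I * nu J] for the interval whose
    word is the concatenation of those of [I] and [J]
    ([gibbs_quasi_bernoulli]), so that [q] successive blocks of [m] digits all
    differ from [J] with probability at most [exp (- b * nu J * q)].  With
    [q] of order [2^(m / kappa) / m] this is super-exponentially small in [m],
    which absorbs the [2^m] choices of [J] ([ae_not_finitely_covered]).

    If [kappa * e > 1], choose [a] with [1 / kappa < a < e].  An invariant
    measure whose integral of [- phi] exceeds [a] provides, for every [m], a
    point [x] with [- S_m phi x >= m * a]; by bounded distortion, for [m] large,
    the periodic point [y <> 0] constructed in the dyadic interval of level [m]
    of [x] satisfies a similar bound over its period
    ([exists_rare_periodic_point]).  The orbit of [y] stays away from 0, so
    small arcs around [y] lie in dyadic neighbourhoods of [y] of comparable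
    length, and [T^n s] falls at distance less than [n^(- kappa)] from [y]
    with probability at most of order [n^(- kappa * a)], by invariance of [nu].
    By the Borel-Cantelli lemma, applied to the blocks [2^i <= n < 2^(i+1)],
    for almost every [s] the point [y] is covered only finitely often
    ([ae_finitely_covered]). *)

Set Implicit Arguments.
Unset Strict Implicit.
Unset Printing Implicit Defensive.

Import Order.TTheory GRing.Theory Num.Theory.
Import numFieldNormedType.Exports.

Local Open Scope classical_set_scope.
Local Open Scope ring_scope.

(** * Probability spaces *)

Section probability_space.
Context {d : measure_display} {X : measurableType d} {R : realType}.
Variable mu : probability X R.

Lemma fine_probability A : measurable A -> mu A = (fine (mu A))%:E.
Proof. by move=> mA; rewrite fineK// fin_num_measure. Qed.

Lemma fine_probability_ge0 A : 0 <= fine (mu A).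
Proof. by rewrite fine_ge0. Qed.

Lemma fine_probability_le1 A : measurable A -> fine (mu A) <= 1.
Proof. by move=> mA; rewrite -lee_fin -fine_probability// probability_le1. Qed.

(** The intersection of a sequence of covers of vanishing measure is a measurable null cover. *)
Lemma negligible_small_cover (A : set X) :
  (forall eps : R, 0 < eps ->
     exists2 B, measurable B /\ A `<=` B & fine (mu B) <= eps) ->
  mu.-negligible A.
Proof.
move=> small.
have /choice[B BP] n : exists B,
    [/\ measurable B, A `<=` B & fine (mu B) <= n.+1%:R^-1].
  have [|B [mB AB] Bn] := small n.+1%:R^-1; first by rewrite invr_gt0 ltr0n.
  by exists B.
have mB : measurable (\bigcap_n B n).
  by apply: bigcap_measurable => // n _; case: (BP n).
exists (\bigcap_n B n); split => //; last by move=> s As n _; case: (BP n) => _ + _; exact.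
rewrite fine_probability//; congr EFin; apply/eqP.
rewrite eq_le fine_probability_ge0 andbT leNgt; apply/negP => pos.
set r := fine _ in pos; have [mBn _ Bn] := BP (Num.trunc r^-1).
have : r <= (Num.trunc r^-1).+1%:R^-1.
  apply: le_trans Bn; rewrite -lee_fin -!fine_probability//.
  by apply: le_measure; rewrite ?inE//; exact: bigcap_inf.
by rewrite leNgt -[ltRHS]invrK ltf_pV2 ?posrE ?ltr0n ?invr_gt0// truncnS_gt.
Qed.

(** The Borel-Cantelli lemma for events of geometrically decaying probability. *)
Lemma lim_sup_set_geometric (E : (set X)^nat) (c rho : R) :
  (forall i, measurable (E i)) -> 0 <= c -> 0 < rho < 1 ->
  (forall i, fine (mu (E i)) <= c * rho ^+ i) -> mu (lim_sup_set E) = 0%E.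
Proof.
move=> mE c0 /andP[r0 r1] bnd; apply: lim_sup_set_cvg0 => //.
apply: (@le_lt_trans _ _ (c / (1 - rho))%:E); last exact: ltry.
apply: lime_le; first exact: is_cvg_nneseries.
apply: nearW => n.
rewrite (eq_bigr (fun i => (fine (mu (E i)))%:E)) => [|i _]; last exact: fine_probability.
rewrite sumEFin lee_fin ler_pdivlMr ?subr_gt0//.
suff : (\sum_(0 <= i < n) fine (mu (E i))) * (1 - rho) <= c * (1 - rho ^+ n).
  move=> /le_trans; apply; rewrite ler_piMr//.
  by have := exprn_ge0 n (ltW r0); lra.
elim: n => [|n IH]; first by rewrite big_geq// mul0r expr0 subrr mulr0.
rewrite big_nat_recr//= mulrDl exprS.
have : fine (mu (E n)) * (1 - rho) <= c * rho ^+ n * (1 - rho).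
  by rewrite ler_pM2r ?subr_gt0.
lra.
Qed.

Lemma integrable_bounded (g : X -> R) (M : R) :
  measurable_fun setT g -> (forall x, `|g x| <= M) ->
  mu.-integrable setT (EFin \o g).
Proof.
move=> mg gM; apply: measurable_bounded_integrable => //.
  by rewrite [X in (X < _)%E](probability_setT mu) ltry.
exists M; split; first exact: num_real.
by move=> M' /ltW MM' x _; exact: le_trans (gM x) MM'.
Qed.

Lemma integrable_cstr (r : R) : mu.-integrable setT (EFin \o cst r).
Proof. by apply: (@integrable_bounded _ `|r|) => // x. Qed.

Lemma integral_cstr (r : R) : (\int[mu]_x r%:E = r%:E)%E.
Proof. by rewrite integral_cst//= probability_setT mule1. Qed.

Lemma integral_bounded (g : X -> R) (M : R) :
  measurable_fun setT g -> (forall x, `|g x| <= M) ->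
  exists2 r, (\int[mu]_x (g x)%:E = r%:E)%E & `|r| <= M.
Proof.
move=> mg gM; have ig := integrable_bounded mg gM.
have fi : (\int[mu]_x (g x)%:E)%E \is a fin_num by exact: integrable_fin_num ig.
exists (fine (\int[mu]_x (g x)%:E)%E); first by rewrite fineK.
have u : (\int[mu]_x (g x)%:E <= M%:E)%E.
  rewrite -integral_cstr; apply: le_integral => //; first exact: integrable_cstr.
  by move=> x _ /=; rewrite lee_fin (le_trans (ler_norm _) (gM x)).
have l : ((- M)%:E <= \int[mu]_x (g x)%:E)%E.
  rewrite -integral_cstr; apply: le_integral => //; first exact: integrable_cstr.
  by move=> x _ /=; rewrite lee_fin; have := gM x; rewrite ler_norml => /andP[].
by rewrite ler_norml -!lee_fin fineK// u l.
Qed.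

End probability_space.

Section powers_of_two.
Variable R : realType.

Lemma pow2D (x y : R) : 2 `^ (x + y) = 2 `^ x * 2 `^ y.
Proof. by rewrite powRD// (@pnatr_eq0 R 2) implybT. Qed.

Lemma pow2_gt0 (x : R) : 0 < 2 `^ x.
Proof. by rewrite powR_gt0. Qed.

End powers_of_two.

(** * Binary coding of the doubling map *)

Section symbolic_coding.
Variable R : realType.
Implicit Types (x y : circle R) (n m k j : nat).

Local Notation T := (@doubling R).

(** The index of the dyadic interval of level [n] containing [x]; its binary
    expansion is the word formed by the first [n] binary digits of [x]. *)
Definition dyadic_index n x : nat := Num.trunc (2 ^+ n * circle_val x).

Lemma circle_val_ge0 x : 0 <= circle_val x.
Proof. by case: x => v /= /andP[]. Qed.

Lemma circle_val_lt1 x : circle_val x < 1.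
Proof. by case: x => v /= /andP[]. Qed.

Lemma circle_val_inj : injective (@circle_val R).
Proof. exact: val_inj. Qed.

Lemma scaled_val_ge0 n x : 0 <= 2 ^+ n * circle_val x.
Proof. by rewrite mulr_ge0 ?exprn_ge0 ?circle_val_ge0. Qed.

Lemma dyadic_indexP n x :
  (dyadic_index n x)%:R <= 2 ^+ n * circle_val x < (dyadic_index n x).+1%:R.
Proof. exact: truncn_itv (scaled_val_ge0 n x). Qed.

Lemma dyadicE n k : @dyadic R n k = [set x | dyadic_index n x = k].
Proof.
have n0 : 0 < (2 : R) ^+ n by rewrite exprn_gt0.
apply/seteqP; split => x; rewrite /dyadic /=.
  by rewrite ler_pdivrMr// ltr_pdivlMr// ![_ * 2 ^+ n]mulrC; exact: truncn_def.
move=> <-; have := dyadic_indexP n x.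
by rewrite ler_pdivrMr// ltr_pdivlMr// ![_ * 2 ^+ n]mulrC.
Qed.

Lemma dyadic_index_lt n x : (dyadic_index n x < 2 ^ n)%N.
Proof.
rewrite truncn_lt_nat ?scaled_val_ge0// natrX.
by rewrite -[ltRHS]mulr1 ltr_pM2l ?exprn_gt0// circle_val_lt1.
Qed.

Lemma mod1_id x : mod1 (circle_val x) = x.
Proof.
apply: circle_val_inj => /=; rewrite (_ : Num.floor _ = 0) ?subr0//.
by apply: floor_def; rewrite circle_val_ge0 add0r circle_val_lt1.
Qed.

Lemma val_iter_doubling n x :
  circle_val (iter n T x) = 2 ^+ n * circle_val x - (dyadic_index n x)%:R.
Proof.
rewrite /dyadic_index truncn_floor scaled_val_ge0.
suff -> : circle_val (iter n T x) =
    2 ^+ n * circle_val x - (Num.floor (2 ^+ n * circle_val x))%:~R.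
  rewrite natr_absz ger0_norm// floor_ge0; exact: scaled_val_ge0.
elim: n => [|n IH]; first by have := congr1 (@circle_val R) (mod1_id x);
  rewrite /= expr0 mul1r => ->.
rewrite iterS /= IH exprS -mulrA; set t := 2 ^+ n * _.
rewrite mulrBr.
have -> : 2 * (Num.floor t)%:~R = (2 * Num.floor t)%:~R :> R by rewrite intrM.
rewrite [Num.floor (_ - _)]floorDrz ?rpredN ?intr_int//.
rewrite -[- (2 * _)%:~R]mulrNz intrKfloor intrD mulrNz; lra.
Qed.

(** The first [n + m] digits of [x] are its first [n] digits followed by the
    first [m] digits of [T^n x]. *)
Lemma dyadic_indexD n m x :
  dyadic_index (n + m) x =
  (2 ^ m * dyadic_index n x + dyadic_index m (iter n T x))%N.
Proof.
apply: truncn_def; have := dyadic_indexP m (iter n T x).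
rewrite val_iter_doubling exprD -[(_ + _).+1]addnS !natrD natrM natrX; lra.
Qed.

Lemma dyadic_index_prefix n m x :
  dyadic_index n x = (dyadic_index (n + m) x %/ 2 ^ m)%N.
Proof.
by rewrite dyadic_indexD mulnC divnMDl ?expn_gt0// divn_small ?addn0 ?dyadic_index_lt.
Qed.

Lemma dyadic_index_suffix n m x :
  dyadic_index m (iter n T x) = (dyadic_index (n + m) x %% 2 ^ m)%N.
Proof. by rewrite dyadic_indexD mulnC modnMDl modn_small ?dyadic_index_lt. Qed.

Lemma dyadic_close n x y :
  dyadic_index n x = dyadic_index n y ->
  `|circle_val x - circle_val y| < 2 ^- n.
Proof.
move=> e; have n0 : 0 < (2 : R) ^+ n by rewrite exprn_gt0.
rewrite -(ltr_pM2l n0) divff ?gt_eqF// -{1}(gtr0_norm n0) -normrM mulrBr.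
have := dyadic_indexP n x; have := dyadic_indexP n y; rewrite -e -!natr1 => H1 H2.
rewrite ltr_norml; lra.
Qed.

Lemma dyadic_nonempty n k :
  (k < 2 ^ n)%N -> exists x, dyadic_index n x = k.
Proof.
move=> kn; have n0 : 0 < (2 : R) ^+ n by rewrite exprn_gt0.
have h : 0 <= (k%:R : R) / 2 ^+ n < 1.
  by rewrite divr_ge0 ?ler0n ?(ltW n0)//= ltr_pdivrMr// mul1r -natrX ltr_nat.
exists (Circle h); apply: truncn_def => /=.
by rewrite mulrCA divff ?gt_eqF// mulr1 lexx ltr_nat ltnS leqnn.
Qed.

Lemma periodic_valE p x :
  iter p T x = x -> (2 ^+ p - 1) * circle_val x = (dyadic_index p x)%:R.
Proof. by move=> /(congr1 (@circle_val R)); rewrite val_iter_doubling; lra. Qed.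

(** The point with periodic expansion the word of [k] followed by the digits
    01.  This suffix excludes both 0 and the all-ones word, which would
    represent 0 again. *)
Lemma periodic_point_in_dyadic m k : (k < 2 ^ m)%N ->
  exists y, [/\ dyadic_index m y = k, iter (m + 2) T y = y & 0 < circle_val y].
Proof.
move=> km; set p := (m + 2)%N; set w := (4 * k + 1)%N.
have wp : (w.+1 < 2 ^ p)%N by rewrite /p expnD /w; lia.
have wpR : w.+1%:R < (2 : R) ^+ p by rewrite -natrX ltr_nat.
have w0 : 0 < w%:R :> R by rewrite ltr0n /w; lia.
rewrite -natr1 in wpR.
have q0 : 0 < (2 : R) ^+ p - 1 by lra.
have h : 0 <= w%:R / ((2 : R) ^+ p - 1) < 1.
  by rewrite divr_ge0 ?(ltW w0) ?(ltW q0)//= ltr_pdivrMr// mul1r; lra.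
pose y := Circle h.
have yE : 2 ^+ p * circle_val y = w%:R + circle_val y.
  by rewrite /=; field; rewrite gt_eqF.
have ip : dyadic_index p y = w.
  apply: truncn_def; rewrite yE -natr1.
  by have := circle_val_ge0 y; have := circle_val_lt1 y; lra.
exists y; split.
- by rewrite (dyadic_index_prefix m 2) ip /w; lia.
- by apply: circle_val_inj; rewrite val_iter_doubling ip yE; lra.
- by rewrite /= divr_gt0.
Qed.

Lemma iter_periodic p x n : iter p T x = x -> iter p T (iter n T x) = iter n T x.
Proof. by move=> e; rewrite -iterD addnC iterD e. Qed.

Lemma periodic_val_gt0 p x n : (0 < p)%N -> iter p T x = x -> 0 < circle_val x ->
  0 < circle_val (iter n T x).
Proof.
move=> p0 per x0; rewrite lt_neqAle circle_val_ge0 andbT; apply/eqP => z.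
have iter0 q (u : circle R) : 0 = circle_val u -> circle_val (iter q T u) = 0.
  move=> u0; have := dyadic_indexP q u; have := circle_val_ge0 (iter q T u).
  rewrite val_iter_doubling -u0 mulr0; have := ler0n R (dyadic_index q u); lra.
have perq q : iter (q * p) T x = x by elim: q => //= q IH; rewrite mulSn iterD IH.
have := iter0 (n * p - n)%N _ z; rewrite -iterD subnK ?perq; last by nia.
by move=> x00; rewrite x00 ltxx in x0.
Qed.

(** The points of a nonzero orbit of period [p] are multiples of
    [1 / (2^p - 1)], so they keep a distance [2^-p] from 0 on either side. *)
Lemma periodic_val_margin p x n : (0 < p)%N -> iter p T x = x ->
  0 < circle_val x ->
  2 ^- p <= circle_val (iter n T x) <= 1 - 2 ^- p.
Proof.
move=> p0 per x0; set z := iter n T x.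
have zper : iter p T z = z by exact: iter_periodic.
have zE := periodic_valE zper.
have z0 : 0 < circle_val z by exact: periodic_val_gt0 per x0.
have z1 : circle_val z < 1 by exact: circle_val_lt1.
set a := (2 : R) ^+ p in zE *.
have a2 : 2 <= a.
  rewrite /a -[leLHS]expr1; apply: ler_weXn2l => //; lra.
set i := dyadic_index p z in zE.
have i0 : 1 <= i%:R :> R.
  rewrite ler1n lt0n; apply/eqP => i0; rewrite i0 in zE.
  by move/eqP: zE; rewrite mulf_eq0 (gt_eqF z0) orbF; apply/negP; rewrite gt_eqF//; lra.
have i1 : i%:R + 2 <= a.
  have : i%:R + 1 < a by rewrite -zE; nra.
  by rewrite /a -natrX natr1 ltr_nat -natrD ler_nat; lia.
have av : a * a^-1 = 1 by rewrite divff//; apply/eqP; lra.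
have av0 : 0 < a^-1 by rewrite invr_gt0; lra.
apply/andP; split; nra.
Qed.

End symbolic_coding.

(** * Measurability and invariance *)

Section circle_measurability.
Variable R : realType.

Local Notation T := (@doubling R).

Lemma measurable_circle_val : measurable_fun setT (@circle_val R).
Proof. by move=> _ B mB; exists B. Qed.

Lemma measurable_dyadic n k : measurable (@dyadic R n k).
Proof.
rewrite -[dyadic _ _]setTI.
by have := measurable_circle_val measurableT
  (measurable_itv `[(k%:R / 2 ^+ n : R), (k.+1%:R / 2 ^+ n)[);
  rewrite /dyadic /= set_itvco.
Qed.

Lemma measurable_dyadic_index n (P : set nat) :
  measurable [set s : circle R | P (dyadic_index n s)].
Proof.
rewrite (_ : [set _ | _] = \bigcup_(k in P) @dyadic R n k).
  by apply: bigcup_measurable => k _; exact: measurable_dyadic.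
apply/seteqP; split=> [s Ps|s [k Pk]]; last by rewrite dyadicE /= => ->.
by exists (dyadic_index n s) => //; rewrite dyadicE.
Qed.

Lemma measurable_doubling : measurable_fun setT T.
Proof.
move=> _ _ [B mB <-]; rewrite !setTI.
rewrite (_ : _ @^-1` _ =
  \bigcup_k (@dyadic R 1 k `&` (fun s => 2 * circle_val s - k%:R) @^-1` B)).
  apply: bigcup_measurable => k _; apply: measurableI.
    exact: measurable_dyadic.
  rewrite -[X in measurable X]setTI.
  apply: (_ : measurable_fun setT (fun s => 2 * circle_val s - k%:R)) => //.
  apply: measurable_funB; last exact: measurable_cst.
  by apply: measurable_funM; [exact: measurable_cst|exact: measurable_circle_val].
have valE (s : circle R) : circle_val (T s) = 2 * circle_val s - (dyadic_index 1 s)%:R.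
  by have := val_iter_doubling 1 s; rewrite expr1.
apply/seteqP; split => [s /= Bs|s [k _] []].
  by exists (dyadic_index 1 s) => //=; rewrite dyadicE; split => //; rewrite -valE.
by rewrite dyadicE /= => <-; rewrite -valE.
Qed.

Lemma measurable_iter_doubling n : measurable_fun setT (iter n T).
Proof.
elim: n => [|n IH]; first exact: measurable_id.
exact: measurableT_comp measurable_doubling IH.
Qed.

Lemma measurable_preimage_iter n (A : set (circle R)) :
  measurable A -> measurable [set s | A (iter n T s)].
Proof.
by move=> mA; rewrite -[X in measurable X]setTI; exact: measurable_iter_doubling.
Qed.

Lemma invariant_measure_iter (mu : probability (circle R) R) n A :
  invariant_measure T mu -> measurable A ->
  mu [set s | A (iter n T s)] = mu A.
Proof.
move=> inv; elim: n A => [|n IH] A mA //.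
rewrite -[RHS]inv// -(IH (T @^-1` A)).
  by congr (mu _); apply/seteqP; split => s /=; rewrite -iterS.
exact: (measurable_preimage_iter 1 mA).
Qed.

End circle_measurability.

(** * Hölder potentials and their Birkhoff sums *)

Section birkhoff.
Variables (R : realType) (phi : circle R -> R).
Local Notation T := (@doubling R).

Lemma birkhoff_sum0 x : birkhoff_sum phi 0 x = 0.
Proof. by rewrite /birkhoff_sum big_geq. Qed.

Lemma birkhoff_sumD n m x :
  birkhoff_sum phi (n + m) x = birkhoff_sum phi n x + birkhoff_sum phi m (iter n T x).
Proof.
rewrite /birkhoff_sum (@big_cat_nat _ _ _ n)//= ?leq_addr//; congr (_ + _).
rewrite -{1}[n]add0n big_addn addKn.
by apply: eq_bigr => i _; rewrite -iterD.
Qed.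

Lemma birkhoff_sumS n x :
  birkhoff_sum phi n.+1 x = phi x + birkhoff_sum phi n (T x).
Proof. by rewrite -add1n birkhoff_sumD /birkhoff_sum big_nat1. Qed.

Lemma birkhoff_sumSr n x :
  birkhoff_sum phi n.+1 x = birkhoff_sum phi n x + phi (iter n T x).
Proof. by rewrite /birkhoff_sum big_nat_recr. Qed.

Lemma birkhoff_sum_bound K n x : (forall y, `|phi y| <= K) ->
  `|birkhoff_sum phi n x| <= n%:R * K.
Proof.
move=> phiK; elim: n => [|n IH]; first by rewrite birkhoff_sum0 normr0 mul0r.
rewrite birkhoff_sumSr -natr1 mulrDl mul1r.
by rewrite (le_trans (ler_normD _ _))// lerD.
Qed.

Lemma birkhoff_sum_period p q x : iter p T x = x ->
  birkhoff_sum phi (q * p) x = q%:R * birkhoff_sum phi p x.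
Proof.
move=> per; elim: q => [|q IH]; first by rewrite birkhoff_sum0 mul0r.
by rewrite mulSn birkhoff_sumD per IH -natr1; ring.
Qed.

Hypothesis phi_holder : is_holder phi.

(** A Hölder function oscillates exponentially little on dyadic intervals;
    this is the only form in which the Hölder condition is used. *)
Lemma holder_exp_decay : exists C theta : R, [/\ 0 <= C, 0 < theta, theta < 1 &
  forall n x y, dyadic_index n x = dyadic_index n y ->
    `|phi x - phi y| <= C * theta ^+ n].
Proof.
have [a [C [a0 a1 H]]] := phi_holder.
exists `|C|, (2 `^ (- a)); split => //.
  rewrite powRN invf_lt1 ?powR_gt0//.
  have : 1 `^ a < 2 `^ a by rewrite gt0_ltr_powR ?nnegrE// ltr1n.
  by rewrite powR1.
move=> n x y /dyadic_close xy; apply: (le_trans (H x y)).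
rewrite (le_trans (ler_wpM2r _ (ler_norm C))) ?powR_ge0//.
apply: ler_wpM2l => //.
have -> : (2 `^ (- a)) ^+ n = (2 ^- n : R) `^ a.
  by rewrite -powR_mulrn ?powR_ge0// -powRrM mulNr mulrC -mulNr powRrM powRN powR_mulrn.
have d0 : 0 <= circle_dist x y.
  have [] := (circle_val_ge0 x, circle_val_ge0 y).
  have [] := (circle_val_lt1 x, circle_val_lt1 y).
  move=> *; rewrite le_min normr_ge0/= subr_ge0 ler_norml; lra.
apply: ge0_ler_powR; rewrite ?nnegrE ?invr_ge0 ?exprn_ge0 ?(ltW a0)//.
by rewrite /circle_dist ge_min (ltW xy).
Qed.

Lemma holder_bounded : exists2 K : R, 0 <= K & forall x, `|phi x| <= K.
Proof.
have [C [t [C0 t0 t1 H]]] := holder_exp_decay.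
exists (C + `|phi point|); first by rewrite addr_ge0.
move=> x; have := H 0%N x point; rewrite expr0 mulr1 => h.
rewrite -[phi x](subrK (phi point)) (le_trans (ler_normD _ _))// lerD2r h//.
have := dyadic_index_lt 0 x; have := dyadic_index_lt 0 (point : circle R).
by rewrite expn0 !ltnS !leqn0 => /eqP -> /eqP ->.
Qed.

(** Bounded distortion: the Birkhoff sums up to time [n] are constant, up to a
    uniform error, on dyadic intervals of level [n]. *)
Lemma holder_distortion : exists2 D : R, 0 <= D & forall n x y,
  dyadic_index n x = dyadic_index n y ->
  `|birkhoff_sum phi n x - birkhoff_sum phi n y| <= D.
Proof.
have [C [t [C0 t0 t1 H]]] := holder_exp_decay.
have u0 : 0 < 1 - t by rewrite subr_gt0.
pose D := C * t / (1 - t).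
have D0 : 0 <= D by rewrite divr_ge0 ?mulr_ge0 ?(ltW t0) ?(ltW u0).
have DE : C * t = D * (1 - t) by rewrite /D divfK// gt_eqF.
exists D => // n x y xy.
suff : `|birkhoff_sum phi n x - birkhoff_sum phi n y| <= D * (1 - t ^+ n).
  move=> /le_trans; apply; rewrite ler_piMr//.
  by have := exprn_ge0 n (ltW t0); lra.
(* with C * t = D * (1 - t), the error grows by D * (t^n - t^(n+1)) at step n *)
elim: n x y xy => [|n IH] x y xy.
  by rewrite !birkhoff_sum0 subrr normr0 expr0 subrr mulr0.
rewrite !birkhoff_sumS opprD addrACA (le_trans (ler_normD _ _))//.
have /IH h : dyadic_index n (T x) = dyadic_index n (T y).
  by have := congr1 (fun k => k %% 2 ^ n)%N xy; rewrite -!(dyadic_index_suffix 1).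
have := H n.+1 x y xy; rewrite exprS mulrA DE.
move: h; nra.
Qed.

(** The potential is the pointwise limit of functions of finitely many digits. *)
Lemma holder_measurable : measurable_fun setT phi.
Proof.
have [C [t [C0 t0 t1 H]]] := holder_exp_decay.
pose r n k : circle R := get [set x | dyadic_index n x = k].
have rP n (x : circle R) : dyadic_index n (r n (dyadic_index n x)) = dyadic_index n x.
  by apply: (@getPex _ [set y | dyadic_index n y = dyadic_index n x]); exists x.
apply: (measurable_fun_cvg (h := fun n x => phi (r n (dyadic_index n x)))).
  move=> n _ B mB; rewrite setTI.
  exact: (measurable_dyadic_index R n (fun k => B (phi (r n k)))).
move=> x _; apply/cvgrPdist_lt => e e0.
have : geometric C t n @[n --> \oo] --> (0 : R).
  by apply: cvg_geometric; rewrite gtr0_norm.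
move=> /cvgrPdist_lt /(_ e e0); apply: filterS => n.
rewrite sub0r normrN /= ger0_norm ?mulr_ge0 ?exprn_ge0 ?(ltW t0)//.
apply: le_lt_trans; apply: H.
by rewrite rP.
Qed.

End birkhoff.

(** * Periodic orbits and integrals against invariant measures *)

Section orbit_measure.
Variables (R : realType) (p : nat) (y : circle R).
Local Notation T := (@doubling R).

(** The average of the Dirac masses at [y, T y, ..., T^p y].  It is a
    probability for every [y]; it is invariant when [T^(p+1) y = y].  The
    number of points is [p.+1] so that it is never zero. *)
Definition orbit_measure : set (circle R) -> \bar R :=
  mscale (p.+1%:R^-1)%:nng (msum (fun i => dirac (iter i T y)) p.+1).

HB.instance Definition _ := Measure.on orbit_measure.

Fact orbit_measure_setT : orbit_measure setT = 1%E.
Proof.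
rewrite /orbit_measure /mscale /= /msum (eq_bigr (fun=> 1%E)) => [|i _]; last first.
  by rewrite [LHS]diracE in_setT.
by rewrite sumEFin sumr_const card_ord -EFinM mulVf// pnatr_eq0.
Qed.

HB.instance Definition _ :=
  @Measure_isProbability.Build _ _ _ orbit_measure orbit_measure_setT.

Definition orbit_probability : probability (circle R) R := orbit_measure.

Lemma orbit_probability_invariant :
  iter p.+1 T y = y -> invariant_measure T orbit_probability.
Proof.
move=> per A mA; rewrite /orbit_probability /= /orbit_measure /mscale /msum /=.
congr (_ * _)%E.
rewrite /msum big_ord_recr [RHS]big_ord_recl /= addeC; congr (_ + _)%E.
  by rewrite [LHS]diracE [RHS]diracE /= -[in RHS]per.
Qed.

Lemma integral_orbit_probability (f : circle R -> R) (K : R) :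
  measurable_fun setT f -> (forall x, `|f x| <= K) ->
  (\int[orbit_probability]_x (f x)%:E)%E = (birkhoff_sum f p.+1 y / p.+1%:R)%:E.
Proof.
move=> mf fK.
(* shifting by K reduces to nonnegative integrands *)
have f0 x : 0 <= f x + K by have := fK x; rewrite ler_norml; lra.
have intK : (\int[orbit_probability]_x (f x + K)%:E =
    (birkhoff_sum f p.+1 y / p.+1%:R + K)%:E)%E.
  have mg : measurable_fun setT (fun x => (f x + K)%:E).
    by apply/measurable_EFinP; apply: measurable_funD => //; exact: measurable_cst.
  rewrite ge0_integral_mscale//=; last by move=> x _; rewrite lee_fin.
  rewrite ge0_integral_measure_sum//=; last by move=> x _; rewrite lee_fin.
  under eq_bigr => i _.
    rewrite integral_dirac// [X in (X * _)%E]diracE in_setT mul1e.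
  over.
  rewrite sumEFin -EFinM big_split/= sumr_const card_ord /birkhoff_sum big_mkord.
  by congr EFin; rewrite -[K *+ _]mulr_natl mulrDr mulKf ?pnatr_eq0// mulrC.
move: intK; rewrite (_ : (fun x => _) = (fun x => (f x)%:E + (cst K x)%:E)%E)//.
rewrite integralD//; last exact: integrable_cstr.
  have [r -> _] := integral_bounded orbit_probability mf fK.
  by rewrite integral_cstr => -[/addIr ->].
exact: (integrable_bounded _ mf fK).
Qed.

End orbit_measure.

Section invariant_integrals.
Variables (R : realType) (f : circle R -> R) (K : R).
Hypothesis mf : measurable_fun setT f.
Hypothesis fK : forall x, `|f x| <= K.
Variable mu : probability (circle R) R.
Local Notation T := (@doubling R).

Lemma integral_iter_doubling n : invariant_measure T mu ->
  (\int[mu]_x (f (iter n T x))%:E = \int[mu]_x (f x)%:E)%E.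
Proof.
move=> inv; transitivity (\int[pushforward mu (iter n T)]_x (f x)%:E)%E.
  rewrite integral_pushforward ?preimage_setT//; first exact: measurable_iter_doubling.
    exact/measurable_EFinP.
  apply: (@integrable_bounded _ _ _ _ (f \o iter n T) K) => [|x]; last exact: fK.
  exact: measurableT_comp mf (measurable_iter_doubling n).
apply: eq_measure_integral; first exact: measurable_iter_doubling.
by move=> ? A mA _; exact: (invariant_measure_iter n inv mA).
Qed.

Lemma integral_birkhoff_sum n : invariant_measure T mu ->
  (\int[mu]_x (birkhoff_sum f n x)%:E = n%:R%:E * \int[mu]_x (f x)%:E)%E.
Proof.
move=> inv; have [r rE _] := integral_bounded mu mf fK.
under eq_integral do rewrite /birkhoff_sum -sumEFin.
rewrite integral_sum// => [|i].
  under eq_bigr do rewrite integral_iter_doubling//.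
  by rewrite rE sumEFin sumr_const_nat subn0 -EFinM mulr_natl.
apply: (@integrable_bounded _ _ _ _ (f \o iter i T) K) => [|x]; last exact: fK.
exact: measurableT_comp mf (measurable_iter_doubling i).
Qed.

End invariant_integrals.

(** * The maximal average of the opposite potential *)

Section maximal_average.
Variables (R : realType) (phi : circle R -> R).
Hypothesis phi_holder : is_holder phi.
Local Notation T := (@doubling R).

Lemma measurable_opp_holder : measurable_fun setT (fun x => - phi x).
Proof. exact: measurableT_comp (holder_measurable phi_holder). Qed.

Lemma birkhoff_sumN n x :
  birkhoff_sum (fun x => - phi x) n x = - birkhoff_sum phi n x.
Proof. by rewrite /birkhoff_sum sumrN. Qed.

Lemma e_plus_fin_num (nu : probability (circle R) R) :
  invariant_measure T nu -> exists e, e_plus phi = e%:E.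
Proof.
move=> inv; have [K K0 phiK] := holder_bounded phi_holder.
have NphiK x : `|- phi x| <= K by rewrite normrN.
have mN := measurable_opp_holder.
exists (fine (e_plus phi)); rewrite fineK// fin_real//; apply/andP; split.
  have [r rE _] := integral_bounded nu mN NphiK.
  apply: (lt_le_trans (ltNyr r)); rewrite -rE.
  by apply: ereal_sup_ubound; exists nu.
apply: (@le_lt_trans _ _ K%:E); last exact: ltry.
apply: ge_ereal_sup => _ [mu _ <-].
have [r -> rK] := integral_bounded mu mN NphiK.
by rewrite lee_fin (le_trans (ler_norm _)).
Qed.

Lemma periodic_average_le e p y : e_plus phi = e%:E -> iter p.+1 T y = y ->
  - birkhoff_sum phi p.+1 y <= p.+1%:R * e.
Proof.
move=> eE per; have [K K0 phiK] := holder_bounded phi_holder.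
have NphiK x : `|- phi x| <= K by rewrite normrN.
rewrite -birkhoff_sumN mulrC -ler_pdivrMr ?ltr0n// -lee_fin -eE.
rewrite -(integral_orbit_probability p y measurable_opp_holder NphiK).
apply: ereal_sup_ubound; exists (orbit_probability p y) => //.
exact: orbit_probability_invariant.
Qed.

(** By invariance the integral of [- S_m phi] is [m] times that of [- phi], so
    it exceeds [m * a] for some invariant measure. *)
Lemma exists_large_average e a m : e_plus phi = e%:E -> a < e ->
  exists x, m%:R * a <= - birkhoff_sum phi m x.
Proof.
move=> eE ae; have [K K0 phiK] := holder_bounded phi_holder.
have NphiK x : `|- phi x| <= K by rewrite normrN.
have mN := measurable_opp_holder.
have : (a%:E < e_plus phi)%E by rewrite eE lte_fin.
move=> /ereal_sup_gt[_ [mu inv <-]] alt.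
apply: contrapT => /forallNP nx.
have [r rE _] := integral_bounded mu mN NphiK.
have : (m%:R%:E * \int[mu]_x (- phi x)%:E <= (m%:R * a)%:E)%E.
  rewrite -(integral_birkhoff_sum mN NphiK m inv) -(integral_cstr mu).
  apply: le_integral => //; last first.
  - by move=> x _; rewrite lee_fin birkhoff_sumN ltW// ltNge; exact/negP.
  - exact: integrable_cstr.
  - apply: (@integrable_bounded _ _ _ _ _ (m%:R * K)) => [|x].
      apply: measurable_sum => i.
      exact: measurableT_comp mN (measurable_iter_doubling i).
    exact: birkhoff_sum_bound.
case: m nx => [|m] nx; first by case: (nx point); rewrite mul0r birkhoff_sum0 oppr0.
rewrite rE -EFinM lee_fin ler_pM2l ?ltr0n// => ra.
by move: alt; rewrite rE lte_fin ltNge ra.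
Qed.

End maximal_average.

(** * Gibbs estimates on dyadic intervals *)

Section gibbs_estimates.
Variables (R : realType) (phi : circle R -> R) (nu : probability (circle R) R).
Local Notation T := (@doubling R).

Lemma fine_probability_split n (P : pred nat) (A : set (circle R)) :
  measurable A ->
  fine (nu (A `&` [set s | P (dyadic_index n s)])) =
  \sum_(k < 2 ^ n | P k) fine (nu (A `&` dyadic n k)).
Proof.
move=> mA; have mAd k : measurable (A `&` @dyadic R n k).
  by apply: measurableI => //; exact: measurable_dyadic.
apply: EFin_inj; rewrite -sumEFin -fine_probability; last first.
  by apply: measurableI => //; exact: (measurable_dyadic_index R n (fun k => P k)).
under eq_bigr do rewrite -fine_probability//.
rewrite -measure_bigsetU_ord //.
  congr (nu _); apply/seteqP; split => s.
    move=> [As Ps]; rewrite (bigD1 (Ordinal (dyadic_index_lt n s)))//=.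
    by left; split => //; rewrite dyadicE.
  elim/big_ind: _ => //= [B C IB IC [/IB|/IC]//|k Pk [As]].
  by rewrite dyadicE /= => sk; split=> //=; rewrite sk.
apply/trivIsetP => i j _ _ ij; rewrite -subset0 => s [[_ +] [_ +]].
by rewrite !dyadicE /= => -> /val_inj/eqP; rewrite (negbTE ij).
Qed.

Lemma gibbs_bounds : is_gibbs phi nu -> exists2 c : R, 0 < c & forall n x,
  c^-1 * 2 `^ birkhoff_sum phi n x <= fine (nu (dyadic n (dyadic_index n x)))
    <= c * 2 `^ birkhoff_sum phi n x.
Proof.
move=> [_ [c [c0 H]]]; exists c => // n x.
have [] := H n (dyadic_index n x) x (dyadic_index_lt n x).
  by rewrite dyadicE.
by rewrite fine_probability ?lee_fin => [-> -> //|]; exact: measurable_dyadic.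
Qed.

(** The index [2 ^ m * k + j] is that of the concatenation of the words of [k]
    and [j]. *)
Lemma gibbs_quasi_bernoulli : is_gibbs phi nu ->
  exists2 b : R, 0 < b & forall n m k j, (k < 2 ^ n)%N -> (j < 2 ^ m)%N ->
  b * fine (nu (dyadic n k)) * fine (nu (dyadic m j)) <=
  fine (nu (dyadic (n + m) (2 ^ m * k + j))).
Proof.
move=> /gibbs_bounds[c c0 H]; exists (c^-1 ^+ 3); first by rewrite exprn_gt0 ?invr_gt0.
move=> n m k j kn jm.
have [|x xE] := @dyadic_nonempty R (n + m) (2 ^ m * k + j).
  by rewrite expnD; nia.
have kE : dyadic_index n x = k.
  by rewrite (dyadic_index_prefix n m) xE mulnC divnMDl ?expn_gt0// divn_small ?addn0.
have jE : dyadic_index m (iter n T x) = j.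
  by rewrite dyadic_index_suffix xE mulnC modnMDl modn_small.
have := H (n + m)%N x; rewrite xE birkhoff_sumD pow2D => /andP[h _].
have := H n x; rewrite kE => /andP[_ h1].
have := H m (iter n T x); rewrite jE => /andP[_ h2].
apply: le_trans h; set u := 2 `^ _ in h1 *; set v := 2 `^ _ in h2 *.
rewrite exprS -!mulrA ler_pM2l ?invr_gt0//.
have -> : u * v = c^-1 ^+ 2 * ((c * u) * (c * v)).
  by field; rewrite gt_eqF.
rewrite mulrA -expr2; apply: ler_wpM2l; first by rewrite exprn_ge0// invr_ge0 ltW.
by apply: ler_pM => //; exact: fine_probability_ge0.
Qed.

(** Any dyadic interval of level [m] contains a point of period [m + 2], whose
    Birkhoff average is controlled by the maximal average [e]. *)
Lemma gibbs_lower_bound e : is_holder phi -> is_gibbs phi nu ->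
  e_plus phi = e%:E -> exists2 c1 : R, 0 < c1 & forall m k, (k < 2 ^ m)%N ->
  c1 * 2 `^ (- (m%:R * e)) <= fine (nu (dyadic m k)).
Proof.
move=> ph /gibbs_bounds[c c0 H] eE; have [K K0 phiK] := holder_bounded ph.
exists (c^-1 * 2 `^ (- (2 * e + 2 * K))).
  by rewrite mulr_gt0 ?invr_gt0 ?powR_gt0.
move=> m k km; have [y [yk yper _]] := @periodic_point_in_dyadic R m k km.
have := H m y; rewrite yk => /andP[+ _]; apply: le_trans.
rewrite -mulrA -pow2D ler_pM2l ?invr_gt0// ler_powR ?ler1n//.
have : iter (m + 1).+1 T y = y by rewrite -addn1 -addnA.
move=> /(periodic_average_le ph eE).
rewrite -[(m + 1).+1]addn1 -addnA birkhoff_sumD natrD.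
by have := birkhoff_sum_bound 2 (iter m T y) phiK; rewrite ler_norml; lra.
Qed.

(** If [e <= 0], each of the [2^m] dyadic intervals of level [m] would have
    measure at least [c], for every [m]. *)
Lemma e_plus_gt0 e : is_holder phi -> is_gibbs phi nu ->
  e_plus phi = e%:E -> 0 < e.
Proof.
move=> ph nug eE; have [c c0 H] := gibbs_lower_bound ph nug eE.
rewrite ltNge; apply/negP => e0.
have [m mc] : exists m, c^-1 < m%:R by exists (Num.trunc c^-1).+1; exact: truncnS_gt.
have : \sum_(k < 2 ^ m) c <= fine (nu setT).
  have := fine_probability_split m xpredT measurableT.
  rewrite setTI (_ : [set s | _] = setT) => [->|]; last by apply/seteqP.
  apply: ler_sum => k _; rewrite setTI; apply: le_trans (H m k (ltn_ord k)).
  rewrite ler_pMr// -[leLHS](powRr0 2) ler_powR ?ler1n// oppr_ge0.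
  by rewrite mulr_ge0_le0.
rewrite probability_setT/= sumr_const card_ord -mulr_natl => h.
have : m%:R < (2 ^ m)%:R :> R by rewrite ltr_nat ltn_expl.
have : c^-1 * c = 1 by rewrite mulVf// gt_eqF.
nra.
Qed.

End gibbs_estimates.

(** * Orbits avoiding a dyadic interval *)

Section block_avoidance.
Variable R : realType.
Local Notation T := (@doubling R).

(** Read [k] as a word of [q + 1] blocks of [m] binary digits: none of its last
    [q] blocks is the word of [j].  The first block is left free. *)
Fixpoint avoids_block (m j q k : nat) : bool :=
  if q is q'.+1 then avoids_block m j q' (k %/ 2 ^ m) && (k %% 2 ^ m != j)%N
  else true.

(** The points whose orbit avoids the interval [dyadic m j] at the times
    [m, 2 m, ..., q m]; this is decided by the first [(q + 1) m] digits. *)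
Definition avoiding_set m j q : set (circle R) :=
  [set s | avoids_block m j q (dyadic_index (q.+1 * m) s)].

Lemma avoiding_setS m j q : avoiding_set m j q.+1 =
  avoiding_set m j q `\` (dyadic m j \o iter (q.+1 * m) T).
Proof.
rewrite /avoiding_set; apply/seteqP; split => s; rewrite /= dyadicE /=;
  rewrite -[(q.+2 * m)%N]/(m + q.+1 * m)%N [(m + _)%N]addnC;
  rewrite -dyadic_index_prefix -dyadic_index_suffix.
  by move=> /andP[-> /eqP].
by move=> [-> /eqP].
Qed.

Lemma not_avoiding_hits m j q s : ~ avoiding_set m j q s ->
  exists2 i, (0 < i <= q)%N & dyadic_index m (iter (i * m) T s) = j.
Proof.
elim: q => [[]//|q IH]; rewrite avoiding_setS => /not_andP[/IH|/contrapT].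
  by move=> [i /andP[i0 iq] ij]; exists i; rewrite ?i0 ?(leq_trans iq).
by rewrite /= dyadicE /= => h; exists q.+1; rewrite ?ltnS ?leqnn.
Qed.

Lemma measurable_avoiding_set m j q : measurable (avoiding_set m j q).
Proof. exact: (measurable_dyadic_index R (q.+1 * m) (fun k => avoids_block m j q k)). Qed.

Variables (nu : probability (circle R) R) (b : R).
Hypothesis quasi_bernoulli : forall n m k j, (k < 2 ^ n)%N -> (j < 2 ^ m)%N ->
  b * fine (nu (dyadic n k)) * fine (nu (dyadic m j)) <=
  fine (nu (dyadic (n + m) (2 ^ m * k + j))).

(** Conditionally on any event about the first [n] digits, the next [m] digits
    form the word of [j] with probability at least [b * nu (dyadic m j)]. *)
Lemma hitting_lower_bound n (P : pred nat) m j : (j < 2 ^ m)%N ->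
  b * fine (nu (dyadic m j)) * fine (nu [set s | P (dyadic_index n s)]) <=
  fine (nu ((dyadic m j \o iter n T) `&` [set s | P (dyadic_index n s)])).
Proof.
move=> jm; rewrite fine_probability_split; last first.
  by apply: measurable_preimage_iter; exact: measurable_dyadic.
rewrite -[in leLHS](setTI [set s | _]) fine_probability_split// mulr_sumr.
apply: ler_sum => k _; rewrite setTI mulrAC.
apply: le_trans (quasi_bernoulli (ltn_ord k) jm) _; rewrite le_eqVlt; apply/orP; left.
apply/eqP; congr (fine (nu _)); rewrite !dyadicE; apply/seteqP; split => s /=.
  move=> e; rewrite (dyadic_index_suffix n m) (dyadic_index_prefix n m) e.
  by rewrite mulnC divnMDl ?modnMDl ?expn_gt0// divn_small// modn_small ?addn0.
by move=> [h1 h2]; rewrite dyadic_indexD h1 h2.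
Qed.

Lemma avoiding_set_le m j q d : (j < 2 ^ m)%N ->
  d <= b * fine (nu (dyadic m j)) ->
  fine (nu (avoiding_set m j q)) <= expR (- d * q%:R).
Proof.
move=> jm db; elim: q => [|q IH].
  by rewrite mulr0 expR0 fine_probability_le1//; exact: measurable_avoiding_set.
have mH : measurable (dyadic m j \o iter (q.+1 * m) T : set (circle R)).
  by apply: measurable_preimage_iter; exact: measurable_dyadic.
have mA := measurable_avoiding_set m j q.
have split : fine (nu (avoiding_set m j q)) =
    fine (nu (avoiding_set m j q.+1)) +
    fine (nu ((dyadic m j \o iter (q.+1 * m) T) `&` avoiding_set m j q)).
  apply: EFin_inj; rewrite EFinD -!fine_probability//; last 2 first.
  - exact: measurableI.
  - exact: measurable_avoiding_set.
  by rewrite avoiding_setS setIC -measureDI.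
have h := hitting_lower_bound (q.+1 * m) (avoids_block m j q) jm.
rewrite -/(avoiding_set m j q) in h.
have e1 : 1 - d <= expR (- d) by exact: expR_ge1Dx.
rewrite -natr1 mulrDr mulr1 expRD mulrC.
have u0 := fine_probability_ge0 nu (avoiding_set m j q).
apply: (@le_trans _ _ (expR (- d) * fine (nu (avoiding_set m j q)))); last first.
  by rewrite ler_pM2l ?expR_gt0.
move: (fine _) (fine (nu (avoiding_set m j q))) (fine _) split h u0 => x y z.
nra.
Qed.

End block_avoidance.

Section covering_asymptotics.
Variable R : realType.

(** If each block of [m] digits hits a given interval of level [m] with
    conditional probability at least [A * 2^(- m e)], the left-hand side bounds
    the probability that some interval of level [m] is missed by all the blocks;
    it is arbitrarily small for suitable large [m]. *)
Lemma covering_asymptotics (e kappa A : R) : 0 <= e -> 0 < A -> 0 < kappa ->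
  kappa * e < 1 -> forall (eps : R) M, 0 < eps -> exists2 m, (M <= m)%N &
  (2 ^ m)%:R * expR (- (A * 2 `^ (- (m%:R * e))) *
     (Num.trunc (2 `^ (m%:R / kappa) / m%:R))%:R) <= eps.
Proof.
move=> e0 A0 k0 ke eps M eps0.
have ln20 : 0 < ln 2 :> R by rewrite ln_gt0// ltr1n.
pose h := (kappa^-1 - e) * ln 2 / 3.
have h0 : 0 < h.
  rewrite divr_gt0// mulr_gt0// subr_gt0 -(ltr_pM2l k0) divff// gt_eqF//.
pose w := A * h ^+ 3.
have w0 : 0 < w by rewrite mulr_gt0// exprn_gt0.
pose m := (M + (Num.trunc ((2 + A) / w)).+1 + (Num.trunc eps^-1).+1)%N.
exists m; first by rewrite /m -addnA leq_addr.
have m1 : (2 + A) / w <= m%:R.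
  apply: ltW; apply: (lt_le_trans (truncnS_gt _)); by rewrite ler_nat /m addnAC leq_addl.
have m2 : eps^-1 <= m%:R.
  apply: ltW; apply: (lt_le_trans (truncnS_gt _)); by rewrite ler_nat /m leq_addl.
have m3 : 1 <= m%:R :> R by rewrite ler1n /m addnS.
move: m m1 m2 m3 => m m1 m2 m3.
have m0 : 0 < m%:R :> R by lra.
set q := Num.trunc _.
have q1 : 2 `^ (m%:R / kappa) / m%:R - 1 <= q%:R.
  by rewrite lerBlDr natr1 ltW// truncnS_gt.
have pow_exp (x : R) : 2 `^ x = expR (x * ln 2) by rewrite /powR (@pnatr_eq0 R 2).
(* exp (3 h m) = exp (h m) ^ 3 >= (h m) ^ 3: a cubic bound beats the factor
   1 / m and still leaves m ^ 2, which dominates log (2 ^ m) *)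
have key : h ^+ 3 * m%:R ^+ 3 <= 2 `^ (m%:R / kappa) * 2 `^ (- (m%:R * e)).
  rewrite -pow2D pow_exp.
  have -> : (m%:R / kappa - m%:R * e) * ln 2 = 3%:R * (h * m%:R).
    by rewrite /h; field; rewrite gt_eqF.
  rewrite expRM_natl -exprMn; apply: lerXn2r; rewrite ?nnegrE ?expR_ge0//.
    by rewrite mulr_ge0 ?(ltW h0) ?(ltW m0).
  by apply: le_trans (expR_ge1Dx _); lra.
have tau1 : 2 `^ (- (m%:R * e)) <= 1.
  rewrite -[leRHS](powRr0 2) ler_powR ?ler1n// oppr_le0 mulr_ge0// ltW//.
set tau := 2 `^ (- (m%:R * e)) in key tau1 *.
have tau0 : 0 < tau by rewrite powR_gt0.
have twom : (2 ^ m)%:R <= expR m%:R :> R.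
  rewrite natrX -[m%:R in leRHS]mulr1 expRM_natl lerXn2r ?nnegrE ?expR_ge0//.
  by apply: le_trans (expR_ge1Dx _); lra.
have main : 2 * m%:R <= A * tau * q%:R.
  have h1 : w * m%:R ^+ 2 <= A * tau * (2 `^ (m%:R / kappa) / m%:R).
    rewrite mulrA ler_pdivlMr//.
    have -> : w * m%:R ^+ 2 * m%:R = A * (h ^+ 3 * m%:R ^+ 3) by rewrite /w; ring.
    by rewrite -mulrA [tau * _]mulrC ler_pM2l.
  have h2 : A * tau <= A by rewrite ler_piMr// ltW.
  have h3 : 2 * m%:R + A <= w * m%:R ^+ 2.
    have : 2 + A <= w * m%:R by rewrite mulrC -ler_pdivrMr.
    nra.
  have h4 : A * tau * (2 `^ (m%:R / kappa) / m%:R - 1) <= A * tau * q%:R.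
    by rewrite ler_pM2l ?mulr_gt0.
  lra.
apply: (@le_trans _ _ (expR m%:R * expR (- (A * tau) * q%:R))).
  by rewrite ler_pM2r ?expR_gt0.
rewrite -expRD; apply: (@le_trans _ _ (expR (- m%:R))).
  by rewrite ler_expR; lra.
rewrite expRN invf_ple ?posrE ?expR_gt0//.
by apply: (le_trans m2); apply: le_trans (expR_ge1Dx _); lra.
Qed.

End covering_asymptotics.

(** * Covering of the whole circle for small exponents *)

Section full_covering.
Variables (R : realType) (phi : circle R -> R) (nu : probability (circle R) R).
Local Notation T := (@doubling R).

Lemma same_dyadic_J_arc kappa n m s y :
  2 ^- m <= n%:R `^ (- kappa) ->
  dyadic_index m (iter n T s) = dyadic_index m y -> J_arc kappa n s y.
Proof.
move=> mn /dyadic_close h; rewrite /J_arc; exists (circle_val y); last exact: mod1_id.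
rewrite /= in_itv /=; have := lt_le_trans h mn; rewrite ltr_norml; lra.
Qed.

Lemma ae_not_finitely_covered kappa e : is_holder phi -> is_gibbs phi nu ->
  e_plus phi = e%:E -> 0 < kappa -> kappa * e < 1 ->
  {ae nu, forall s, finitely_covered kappa s = set0}.
Proof.
move=> ph nug eE k0 ke; have e0 := e_plus_gt0 ph nug eE.
have [b b0 qb] := gibbs_quasi_bernoulli nug.
have [c1 c10 lb] := gibbs_lower_bound ph nug eE.
(* q m is the largest number of blocks with m * q m <= 2^(m / kappa); B m is
   the event that some interval of level m is missed at the block times *)
pose q m := Num.trunc (2 `^ (m%:R / kappa) / m%:R : R).
pose B m : set (circle R) := \big[setU/set0]_(j < 2 ^ m) @avoiding_set R m j (q m).
have mB m : measurable (B m).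
  by apply: bigsetU_measurable => j _; exact: measurable_avoiding_set.
have nuB m : fine (nu (B m)) <= (2 ^ m)%:R *
    expR (- (b * c1 * 2 `^ (- (m%:R * e))) * (q m)%:R).
  have : (nu (B m) <= \sum_(j < 2 ^ m) nu (avoiding_set m j (q m)))%E.
    apply: (Boole_inequality nu (A := fun j => avoiding_set m j (q m))) => j _.
    exact: measurable_avoiding_set.
  rewrite fine_probability//.
  under eq_bigr do rewrite (fine_probability nu (measurable_avoiding_set _ _ _ _)).
  rewrite sumEFin lee_fin => /le_trans; apply.
  rewrite mulr_natl -[(2 ^ m)%N in leRHS]card_ord -sumr_const.
  apply: ler_sum => j _; apply: (avoiding_set_le (b := b)) => //.
  by rewrite -mulrA ler_pM2l// lb.
have N0 M : nu.-negligible (\bigcap_(m in [set m | (M <= m)%N]) B m).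
  apply: negligible_small_cover => eps eps0.
  have [m Mm h] := covering_asymptotics (ltW e0) (mulr_gt0 b0 c10) k0 ke M eps0.
  exists (B m); last exact: le_trans (nuB m) h.
  by split => //; exact: bigcap_inf.
(* outside the null set, level m succeeds for some m >= N, and the hit occurs
   at a time i * m >= N *)
apply: negligibleS (negligible_bigcup N0) => s /= /eqP/set0P[y [N /= N1 ycov]].
apply: contrapT => nbad.
have {nbad} [m Nm nB] : exists2 m, (N <= m)%N & ~ B m s.
  apply: contrapT => H; apply: nbad; exists N => // m /= Nm.
  by apply: contrapT => nB; apply: H; exists m.
have m0 : (0 < m)%N by exact: leq_trans Nm.
have nav : ~ @avoiding_set R m (dyadic_index m y) (q m) s.
  move=> h; apply: nB; rewrite /B (bigD1 (Ordinal (dyadic_index_lt m y)))//=.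
  by left.
have [i /andP[i0 iq] ij] := not_avoiding_hits nav.
apply: (ycov (i * m)%N); first by apply: leq_trans Nm _; rewrite /= leq_pmull.
apply: same_dyadic_J_arc ij.
have im : (i * m)%:R <= 2 `^ (m%:R / kappa) :> R.
  rewrite natrM -ler_pdivlMr ?ltr0n//.
  have := truncn_le (2 `^ (m%:R / kappa) / m%:R : R).
  rewrite divr_ge0 ?ler0n ?powR_ge0// => /(le_trans _); apply.
  by rewrite ler_nat.
rewrite powRN lef_pV2 ?posrE ?exprn_gt0 ?powR_gt0 ?ltr0n ?muln_gt0 ?i0 ?m0//.
have -> : (2 : R) ^+ m = (2 `^ (m%:R / kappa)) `^ kappa.
  by rewrite -powRrM divfK ?gt_eqF// powR_mulrn.
by apply: ge0_ler_powR; rewrite ?nnegrE ?(ltW k0) ?powR_ge0.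
Qed.

End full_covering.

(** * Points covered finitely often for large exponents *)

Section partial_covering.
Variables (R : realType) (phi : circle R -> R) (nu : probability (circle R) R).
Local Notation T := (@doubling R).

Lemma exists_rare_periodic_point e a : is_holder phi -> e_plus phi = e%:E ->
  a < e -> exists p y, [/\ (0 < p)%N, iter p T y = y, 0 < circle_val y &
    p%:R * a <= - birkhoff_sum phi p y].
Proof.
move=> ph eE ae; have [K K0 phiK] := holder_bounded ph.
have [D D0 dist] := holder_distortion ph.
pose a1 := (a + e) / 2.
have [a1e aa1] : a1 < e /\ a < a1 by rewrite /a1; split; lra.
pose m := (Num.trunc ((D + 2 * K + 2 * a) / (a1 - a))).+1.
have mlarge : D + 2 * K + 2 * a <= m%:R * (a1 - a).
  by rewrite -ler_pdivrMr ?subr_gt0//; apply: ltW; exact: truncnS_gt.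
have [x xm] := exists_large_average ph m eE a1e.
have [y [ym yper y0]] := periodic_point_in_dyadic R (dyadic_index_lt m x).
exists (m + 2)%N, y; split => //.
rewrite birkhoff_sumD natrD; have := dist m x y (esym ym).
have := birkhoff_sum_bound 2 (iter m T y) phiK.
rewrite !ler_norml; lra.
Qed.

(** Along a periodic orbit, the Birkhoff sums at all times follow their average
    over a period, up to a bounded error. *)
Lemma birkhoff_sum_periodic_le p y a : is_holder phi -> (0 < p)%N ->
  iter p T y = y -> p%:R * a <= - birkhoff_sum phi p y ->
  exists D : R, forall k, birkhoff_sum phi k y <= D - k%:R * a.
Proof.
move=> ph p0 per ap; have [K K0 phiK] := holder_bounded ph.
exists (p%:R * K + p%:R * `|a|) => k.
rewrite {1 2}(divn_eq k p) birkhoff_sumD birkhoff_sum_period// natrD natrM.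
have -> : iter (k %/ p * p) T y = y.
  by elim: (k %/ p)%N => //= q IH; rewrite mulSn iterD IH.
have kp : (k %% p)%:R <= p%:R :> R by rewrite ler_nat ltnW// ltn_pmod.
have := birkhoff_sum_bound (k %% p) y phiK; rewrite ler_norml => /andP[_ h].
have hK : (k %% p)%:R * K <= p%:R * K by rewrite ler_wpM2r.
have ha : (k %% p)%:R * a <= p%:R * `|a|.
  rewrite (le_trans (ler_wpM2l _ (ler_norm a)))// ler_wpM2r//.
have hq : (k %/ p)%:R * birkhoff_sum phi p y <= (k %/ p)%:R * (- (p%:R * a)).
  by rewrite ler_wpM2l//; lra.
lra.
Qed.

(** An arc of radius [2^-(k + p)] around a point [y] of period [p] lies in the
    dyadic interval of level [k] of [y], as [T^k y] is at distance at least
    [2^-p] from 0.  In particular the arc does not wrap around 0. *)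
Lemma J_arc_periodic_dyadic kappa n p k s y : (0 < p)%N -> iter p T y = y ->
  0 < circle_val y -> n%:R `^ (- kappa) <= 2 ^- (k + p) ->
  J_arc kappa n s y -> dyadic_index k (iter n T s) = dyadic_index k y.
Proof.
move=> p0 per y0 rk [t]; set v := circle_val _; rewrite /= in_itv /= => /andP[t1 t2] ty.
have /andP[m1 m2] := periodic_val_margin k p0 per y0.
have := congr1 (@circle_val R) ty => /= tE.
rewrite val_iter_doubling in m1 m2.
set z := v - (Num.floor t)%:~R.
have k0 : 0 < (2 : R) ^+ k by rewrite exprn_gt0.
have zy : `|2 ^+ k * z - 2 ^+ k * circle_val y| < 2 ^- p.
  have -> : (2 : R) ^- p = 2 ^+ k * 2 ^- (k + p).
    by rewrite exprD invfM mulrA divff ?mul1r// gt_eqF.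
  rewrite -mulrBr normrM (gtr0_norm k0) ltr_pM2l//; apply: lt_le_trans rk.
  rewrite -tE /z ltr_norml; lra.
move: zy; rewrite ltr_norml => /andP[z1 z2].
have il : (dyadic_index k y).+1%:R <= (2 : R) ^+ k.
  by rewrite -natrX ler_nat dyadic_index_lt.
have i0 : 0 <= (dyadic_index k y)%:R :> R by rewrite ler0n.
rewrite -natr1 in il.
have z0 : 0 < z by rewrite -(pmulr_rgt0 _ k0); lra.
have zl1 : z < 1 by rewrite -(ltr_pM2l k0); lra.
have f0 : Num.floor t = 0.
  have [v0 v1] := (circle_val_ge0 (iter n T s), circle_val_lt1 (iter n T s)).
  rewrite -/v in v0 v1.
  have f1 : Num.floor t < 1 by rewrite -(ltr_int R); rewrite /z in z0; lra.
  have f2 : -1 < Num.floor t by rewrite -(ltr_int R); rewrite /z in zl1; lra.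
  by move: (Num.floor t) f1 f2 => F f1 f2; clear -f1 f2; lia.
have vz : v = z by rewrite /z f0 subr0.
apply: truncn_def; rewrite -/v vz -natr1; lra.
Qed.

Lemma ae_finitely_covered kappa e : is_holder phi -> is_gibbs phi nu ->
  e_plus phi = e%:E -> 0 < kappa -> 1 < kappa * e ->
  {ae nu, forall s, finitely_covered kappa s !=set0}.
Proof.
move=> ph nug eE k0 ke; have [inv _] := nug.
pose a := (kappa^-1 + e) / 2.
have kV : kappa * kappa^-1 = 1 by rewrite divff// gt_eqF.
have ka : 1 < kappa * a by rewrite /a; lra.
have kVe : kappa^-1 < e by rewrite -(ltr_pM2l k0) kV.
have ae : a < e by rewrite /a; lra.
have a0 : 0 < a by rewrite -(pmulr_rgt0 _ k0); lra.
have [p [y [p0 per y0 ap]]] := exists_rare_periodic_point ph eE ae.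
have [D Dle] := birkhoff_sum_periodic_le ph p0 per ap.
have [c c0 gb] := gibbs_bounds nug.
(* for n >= 2^i the radius n^(-kappa) is at most 2^-(k i + p) as soon as
   kappa * i >= p, so a visit within n^(-kappa) of y at a time n with
   2^i <= n < 2^(i+1) puts s in E i *)
pose k i := (Num.trunc (kappa * i%:R) - p)%N.
pose E i : set (circle R) := \big[setU/set0]_(n < 2 ^ i)
  (dyadic (k i) (dyadic_index (k i) y) \o iter (2 ^ i + n) T).
have mP i n : measurable
    (dyadic (k i) (dyadic_index (k i) y) \o iter (2 ^ i + n) T).
  by apply: measurable_preimage_iter; exact: measurable_dyadic.
have mE i : measurable (E i) by apply: bigsetU_measurable => n _.
pose C := c * 2 `^ (D + a * (1 + p%:R)).
pose rho := 2 `^ (1 - kappa * a).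
have rho1 : 0 < rho < 1.
  rewrite pow2_gt0/= /rho /powR (@pnatr_eq0 R 2) /= expR_lt1.
  by rewrite pmulr_llt0 ?ln_gt0 ?ltr1n// subr_lt0.
have nuE i : fine (nu (E i)) <= C * rho ^+ i.
  have : (nu (E i) <= \sum_(n < 2 ^ i) nu
      (dyadic (k i) (dyadic_index (k i) y) \o iter (2 ^ i + n) T))%E.
    by apply: (Boole_inequality nu (A := fun n =>
      dyadic (k i) (dyadic_index (k i) y) \o iter (2 ^ i + n) T)) => n _.
  rewrite fine_probability//.
  rewrite (eq_bigr (fun=> (fine (nu (dyadic (k i) (dyadic_index (k i) y))))%:E)); last first.
    move=> n _; rewrite (invariant_measure_iter _ inv (@measurable_dyadic _ _ _)).
    by rewrite -fine_probability//; exact: measurable_dyadic.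
  rewrite sumEFin lee_fin sumr_const card_ord -mulr_natl => /le_trans; apply.
  have /andP[_ h] := gb (k i) y.
  apply: (le_trans (ler_wpM2l _ h)) => //.
  have -> : (2 ^ i)%:R = 2 `^ i%:R :> R by rewrite powR_mulrn// natrX.
  rewrite -(powR_mulrn i (ltW (pow2_gt0 _))) -powRrM /C.
  rewrite mulrCA -mulrA ler_pM2l// -!pow2D ler_powR ?ler1n//.
  have := Dle (k i).
  have : kappa * i%:R - 1 - p%:R <= (k i)%:R.
    rewrite lerBlDr -natrD lerBlDr natr1.
    apply: ltW; apply: (lt_le_trans (truncnS_gt _)); rewrite ler_nat ltnS.
    by rewrite addnC -leq_subLR.
  move=> h1; have : a * (kappa * i%:R - 1 - p%:R) <= a * (k i)%:R by rewrite ler_pM2l.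
  lra.
have lim0 := lim_sup_set_geometric mE (ltW (mulr_gt0 c0 (pow2_gt0 _))) rho1 nuE.
have mlim : measurable (lim_sup_set E).
  by apply: bigcap_measurable => // n _; apply: bigcup_measurable.
exists (lim_sup_set E); split => // s /= nfc.
apply: contrapT => /existsNP[I /not_implyP[_ nI]].
apply: nfc; exists y.
(* s lies outside E i for i >= I; i0 also ensures kappa * i >= p *)
pose i0 := (maxn I (Num.trunc (p%:R / kappa)).+1).
exists (2 ^ i0)%N; first by rewrite /= expn_gt0.
move=> n /= nN yJ; apply: nI.
have n0 : (0 < n)%N by apply: leq_trans nN; rewrite expn_gt0.
pose i := trunc_log 2 n.
have /andP[in1 in2] : (2 ^ i <= n < 2 ^ i.+1)%N by exact: trunc_log_bounds.
have ii0 : (i0 <= i)%N by exact: trunc_log_max.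
exists i; first by rewrite /= (leq_trans _ ii0)// leq_maxl.
have nlt : (n - 2 ^ i < 2 ^ i)%N by rewrite ltn_subLR// addnn -mul2n -expnS.
rewrite /E (bigD1 (Ordinal nlt))//=; left; rewrite /= subnKC// dyadicE /=.
apply: (J_arc_periodic_dyadic p0 per y0 _ yJ).
have ki : (k i + p = Num.trunc (kappa * i%:R))%N.
  rewrite /k subnK// truncn_ge_nat ?mulr_ge0 ?(ltW k0)// mulrC -ler_pdivrMr//.
  apply: ltW; apply: (lt_le_trans (truncnS_gt _)); rewrite ler_nat.
  by apply: leq_trans ii0; rewrite leq_maxr.
rewrite ki powRN lef_pV2 ?posrE ?exprn_gt0 ?powR_gt0 ?ltr0n//.
apply: (@le_trans _ _ (2 `^ (kappa * i%:R))).
  rewrite -powR_mulrn// ler_powR ?ler1n// truncn_le.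
  by rewrite mulr_ge0// ltW.
rewrite mulrC powRrM powR_mulrn// -natrX.
by apply: ge0_ler_powR; rewrite ?nnegrE ?(ltW k0)// ler_nat.
Qed.

End partial_covering.

(** * The critical exponent *)

Theorem theorem1p2 (R : realType) (phi : circle R -> R)
    (nu : probability (circle R) R)
    (phi_holder : is_holder phi)
    (phi_normalized : pressure phi = 0%E)
    (nu_gibbs : is_gibbs phi nu) :
  kappa_F nu = ((e_plus phi)^-1)%E.
Proof.
have [inv _] := nu_gibbs.
have [e eE] := e_plus_fin_num phi_holder inv.
have e0 := e_plus_gt0 phi_holder nu_gibbs eE.
have eV : e^-1 * e = 1 by rewrite mulVf// gt_eqF.
rewrite eE inver gt_eqF//; apply/eqP; rewrite eq_le; apply/andP; split.
  apply: ge_ereal_sup => _ [kappa [k0 empty] <-].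
  rewrite lee_fin leNgt; apply/negP => ek.
  have ke : 1 < kappa * e by rewrite -eV ltr_pM2r.
  have nonempty := ae_finitely_covered phi_holder nu_gibbs eE k0 ke.
  have : nu.-negligible setT.
    apply: negligibleS (negligibleU empty nonempty) => s _ /=.
    case: (pselect (finitely_covered kappa s = set0)) => [->|]; last by left.
    by right=> -[].
  move=> /(measure_negligible measurableT); rewrite [X in X = _](probability_setT nu) => /eqP.
  by rewrite onee_eq0.
apply/lee_addgt0Pr => eps eps0.
have eV0 : 0 < e^-1 by rewrite invr_gt0.
pose kappa := Num.max (e^-1 - eps) (e^-1 / 2).
have k1 : e^-1 - eps <= kappa by rewrite le_max lexx.
have k0 : 0 < kappa by rewrite lt_max divr_gt0// orbT.
have k2 : kappa < e^-1 by rewrite gt_max; lra.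
have : (kappa%:E <= kappa_F nu)%E.
  apply: ereal_sup_ubound; exists kappa => //; split => //.
  by apply: (ae_not_finitely_covered phi_holder nu_gibbs eE k0); rewrite -eV ltr_pM2r.
move=> /(leeD2r eps%:E); apply: le_trans.
by rewrite -EFinD lee_fin -lerBlDr.
Qed.
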